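(* Let $Z$ be a join graph on $n\ge3$ vertices. If $Z$ admits Laplacian fractional revival at time $\tau$, then $\tau$ is an integer multiple of $2\pi/n$.
   Context: For a graph with Laplacian $L=D-A$ and $U(t)=\exp(itL)$, Laplacian fractional revival from $a$ to $b\neq a$ at time $\tau$ means $U(\tau)e_a=\alpha e_a+\beta e_b$ for some complex $\alpha,\beta$. A join graph is a graph of the form $X+Y$ with $X,Y$ graphs on at least one vertex each, where $X+Y$ is obtained from the disjoint union of $X$ and $Y$ by joining every vertex of $X$ to every vertex of $Y$. *)

(* Defs.v *)
From HB Require Import structures.
From mathcomp Require Import all_boot all_order all_algebra.
From mathcomp Require Import complex.
From mathcomp Require Import all_classical all_reals all_analysis.

Set Implicit Arguments.
Unset Strict Implicit.
Unset Printing Implicit Defensive.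

Import Order.TTheory GRing.Theory Num.Theory.
Import numFieldNormedType.Exports.

Local Open Scope classical_set_scope.
Local Open Scope ring_scope.
Local Open Scope complex_scope.

Record sgraph := SGraph {
  vertex :> finType;
  adj : rel vertex;
  adj_sym : symmetric adj;
  adj_irrefl : irreflexive adj }.

Arguments adj {s} x y.

Definition sgraph_iso (X Y : sgraph) : Prop :=
  exists2 f : X -> Y, bijective f & forall u v, adj (f u) (f v) = adj u v.

Section Join.
Variables X Y : sgraph.

Definition join_adj (u v : X + Y) : bool :=
  match u, v with
  | inl x, inl x' => adj x x'
  | inr y, inr y' => adj y y'
  | _, _ => true
  end.

Lemma join_adj_sym : symmetric join_adj.
Proof. by move=> [x|y] [x'|y'] //=; apply: adj_sym. Qed.

Lemma join_adj_irrefl : irreflexive join_adj.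
Proof. by move=> [x|y] /=; apply: adj_irrefl. Qed.

Definition join : sgraph := SGraph join_adj_sym join_adj_irrefl.

End Join.

Definition is_join (Z : sgraph) : Prop :=
  exists X Y : sgraph,
    [/\ (0 < #|X|)%N, (0 < #|Y|)%N & sgraph_iso Z (join X Y)].

(* Matrices of a graph are indexed by 'I_#|Z| through the enumeration of the
   vertices (enum_val / enum_rank). *)
Section GraphMatrices.
Variables (K : pzRingType) (Z : sgraph).

Definition degree (v : Z) : nat := #|[set w : Z | adj v w]%SET|.

Definition adjacency_mx : 'M[K]_#|Z| :=
  \matrix_(i, j) (adj (enum_val i) (enum_val j))%:R.

Definition degree_mx : 'M[K]_#|Z| := diag_mx (\row_i (degree (enum_val i))%:R).

Definition laplacian_mx : 'M[K]_#|Z| := degree_mx - adjacency_mx.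

Definition basis_vec (v : Z) : 'cV[K]_#|Z| := delta_mx (enum_rank v) 0.

End GraphMatrices.

(* The limit is for the entrywise topology on matrices. The series converges for
   every A when K = R[i], the only case used; over a general K it need not. *)
Definition expmx (K : numFieldType) (n : nat) (A : 'M[K]_n) : 'M[K]_n :=
  lim (series (fun k => (k`!%:R)^-1 *: A ^+ k) @ \oo).

Definition transition_mx (R : realType) (Z : sgraph) (t : R) : 'M[R[i]]_#|Z| :=
  expmx (('i%C * t%:C) *: laplacian_mx R[i] Z).

(* beta = 0, i.e. periodicity at a, is allowed. *)
Definition laplacian_fractional_revival (R : realType) (Z : sgraph) (a b : Z)
    (tau : R) : Prop :=
  a != b /\ exists alpha beta : R[i],
    transition_mx Z tau *m basis_vec R[i] a =
      alpha *: basis_vec R[i] a + beta *: basis_vec R[i] b.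

Definition admits_laplacian_fractional_revival (R : realType) (Z : sgraph)
    (tau : R) : Prop :=
  exists a b : Z, laplacian_fractional_revival a b tau.

(* Main.v *)
(** Let [L] be the Laplacian, [n] the number of vertices and [U = exp (i t L)].
    If [x] and [y] lie on different sides of the join then [(L^k) x y = - n^(k-1)]
    for [k >= 1], so [U x y = (1 - e) / n] with [e = exp (i t n)].  Suppose
    [U e_a = alpha e_a + beta e_b].  If [b] is on the side of [a], an entry of
    column [a] on the other side vanishes and [e = 1].  Otherwise
    [beta = (1 - e) / n]; column sums give [alpha + beta = 1] and unitarity gives
    [|alpha|^2 + |beta|^2 = 1], so [|beta|^2 = Re beta], i.e.
    [2 (1 - Re e) / n^2 = (1 - Re e) / n], which for [n > 2] forces [e = 1]. *)
Require Import Defs.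
From mathcomp Require Import all_boot all_order all_algebra.
From mathcomp Require Import complex.
From mathcomp Require Import all_classical all_reals all_analysis.
From mathcomp Require Import lra.

Set Implicit Arguments.
Unset Strict Implicit.
Unset Printing Implicit Defensive.

Import Order.TTheory GRing.Theory Num.Theory.
Import numFieldNormedType.Exports.

Local Open Scope classical_set_scope.
Local Open Scope ring_scope.
Local Open Scope complex_scope.
Local Open Scope sesquilinear_scope.

(** * Solutions of cos t = 1, and powers of a matrix with constant cross entries *)

Lemma cos_eq1 (R : realType) (t : R) :
  cos t = 1 -> exists m : int, t = m%:~R * (2 * pi).
Proof.
have pi0 : 0 < pi :> R by exact: pi_gt0.
have tpi0 : 0 < 2 * pi :> R by rewrite mulr_gt0.
have periodic2 (a : R) (m : int) : cos (a + m%:~R * (2 * pi)) = cos a.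
  have E k : (Posz k)%:~R * (2 * pi) = pi *+ 2 *+ k :> R.
    by rewrite -[_%:~R]/(k%:R) mulr_natl [2 * _]mulr_natl.
  case: m => k; first by rewrite E (periodicn (@cosD2pi R)).
  rewrite NegzE mulrNz mulNr E.
  by rewrite -[in RHS](subrK (pi *+ 2 *+ k.+1) a) (periodicn (@cosD2pi R)).
move=> cost; set m := Num.floor (t / (2 * pi)); exists m.
have /andP[m_le lt_m] := floor_itv (t / (2 * pi)).
pose r := t - m%:~R * (2 * pi).
have r0 : 0 <= r by rewrite subr_ge0 -ler_pdivlMr.
have r2pi : r < 2 * pi.
  move: lt_m; rewrite -/m ltr_pdivrMr// intrD mulrDl mul1r => ?.
  by rewrite ltrBlDl.
have cosr : cos r = 1 by rewrite -(periodic2 _ m) subrK.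
have cos0_inj (x : R) : 0 <= x -> x <= pi -> cos x = 1 -> x = 0.
  move=> x0 x_le cosx; apply: cos_inj; last by rewrite cos0.
    by rewrite in_itv/= x0.
  by rewrite in_itv/= lexx ltW.
apply/eqP; rewrite -subr_eq0; apply/eqP; rewrite -/r.
case: (leP r pi) => [r_le|pi_lt]; first exact: cos0_inj.
(* Here pi < r < 2 pi. The reflected angle 2 pi - r lies in [0, pi] and also has cosine 1, so it
   would be 0, against [r2pi]. *)
suff : 2 * pi - r = 0 by lra.
apply: cos0_inj; [lra|lra|].
by rewrite -cosN opprB -(periodic2 _ 1) mul1r subrK.
Qed.

(* Summing row [i] of [L ^+ k * L] by sides, the vanishing row and column sums turn
   each side into its cardinal, so every step multiplies the entry by [n]. *)
Lemma cross_entry_exp (K : comPzRingType) n (L : 'M[K]_n) (s : 'I_n -> bool) :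
  (forall i, \sum_j L i j = 0) -> (forall j, \sum_i L i j = 0) ->
  (forall i j, s i != s j -> L i j = -1) ->
  forall k i j, s i != s j -> (L ^+ k.+1) i j = - n%:R ^+ k.
Proof.
move=> row0 col0 Lij; elim=> [|k IH] i j sij; first by rewrite expr1 expr0 Lij.
have rowk : \sum_l (L ^+ k.+1) i l = 0.
  rewrite exprSr; under eq_bigr do rewrite mxE.
  by rewrite exchange_big big1 // => l _; rewrite -mulr_sumr row0 mulr0.
have splitS (F : 'I_n -> K) :
    \sum_l F l = \sum_(l | s l != s i) F l + \sum_(l | s l == s i) F l.
  rewrite (bigID (fun l => s l != s i)); congr (_ + _).
  by apply: eq_bigl => l; rewrite negbK.
have sum_cst (P : pred 'I_n) (c : K) : \sum_(l | P l) c = #|P|%:R * c.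
  by rewrite big_const iter_addr addr0 mulr_natl.
rewrite exprSr mxE splitS.
under eq_bigr => l sl do rewrite IH 1?eq_sym//.
rewrite [X in _ + X](eq_bigr (fun l => - (L ^+ k.+1) i l)); last first.
  by move=> l /eqP sl; rewrite Lij ?mulrN1// sl.
rewrite -mulr_sumr sumrN.
have -> : \sum_(l | s l == s i) (L ^+ k.+1) i l = #|[pred l | s l != s i]|%:R * n%:R ^+ k.
  move: rowk; rewrite splitS; under eq_bigr => l sl do rewrite IH 1?eq_sym//.
  by rewrite sum_cst addrC mulrN => /eqP; rewrite subr_eq0 => /eqP.
have -> : \sum_(l | s l != s i) L l j = #|[pred l | s l == s i]|%:R.
  have := col0 j; rewrite splitS => /eqP; rewrite addr_eq0 => /eqP ->.
  rewrite (eq_bigr (fun=> -1)); last by move=> l /eqP sl; rewrite Lij// sl.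
  by rewrite sum_cst mulrN1 opprK.
rewrite mulNr -opprD [_ * n%:R ^+ k]mulrC -mulrDr -natrD exprSr; congr (- (_ * _%:R)).
by rewrite -[RHS]card_ord -(cardC [pred l | s l == s i]).
Qed.

(* The topology of analysis is attached to a [numFieldType], so limits in
   [R[i]] are found by unification only through this instance. *)
Local Notation complexF R := (Num.NumField.clone R[i] _).

(** * The exponential series on the imaginary axis *)

Section ComplexLimits.
Variable R : realType.

Lemma cvg_real_complex T (F : set_system T) {FF : Filter F} (u : T -> R) (x : R) :
  u @ F --> x -> (fun k => (u k)%:C : complexF R) @ F --> (x%:C : complexF R).
Proof.
move=> /cvgrPdist_lt ux; apply/cvgrPdist_lt => e e0.
(* Comparable complex numbers have equal imaginary parts, so a positive [e] is real. *)
have [r er] : exists r, e = r%:C by apply/complex_realP; rewrite realE ltW.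
subst e; rewrite ltcR in e0; near=> k.
rewrite -[_ - _](raddfB (real_complex R)) normc_def /= expr0n addr0 sqrtr_sqr ltcR.
by near: k; exact: ux.
Unshelve. all: by end_near. Qed.

(** Given by cosine and sine rather than by its series, so that modulus 1 and the real part can be
    read off directly. *)
Definition expi (t : R) : complexF R := cos t +i* sin t.

Definition expi_coeff (t : R) (k : nat) : complexF R := (k`!%:R)^-1 * ('i * t%:C) ^+ k.

Lemma expi_coeffE t k : expi_coeff t k = cos_coeff t k +i* sin_coeff t k.
Proof.
rewrite /expi_coeff /cos_coeff /sin_coeff /= exprMn.
have -> : 'i ^+ k = (~~ odd k)%:R * ((-1) ^+ k./2)
    +i* ((odd k)%:R * (-1) ^+ k.-1./2) :> R[i].
  rewrite -[in LHS](odd_double_half k) exprD -muln2 mulnC exprM sqr_i.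
  have -> : (-1) ^+ k./2 = ((-1) ^+ k./2)%:C :> R[i] by rewrite rmorphXn rmorphN rmorph1.
  (* For odd [k] the halves [k./2] and [k.-1./2] agree; for even [k] the factor [odd k] kills the
     imaginary part. *)
  case ko : (odd k) => /=; rewrite ?expr1 ?expr0; simpc => //.
  by congr (_ +i* (_ ^+ _)); case: k ko => //= k; rewrite uphalf_half => /negbTE ->.
have -> : (k`!%:R)^-1 = (k`!%:R^-1)%:C :> R[i] by rewrite fmorphV rmorph_nat.
by rewrite -rmorphXn /=; simpc; congr (_ +i* _); rewrite mulrC.
Qed.

Lemma expi0 : expi 0 = 1.
Proof. by rewrite /expi cos0 sin0. Qed.

Lemma cvg_expi t : series (expi_coeff t) @ \oo --> expi t.
Proof.
have -> : series (expi_coeff t) =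
    (fun n => (series (cos_coeff t) n)%:C + 'i * (series (sin_coeff t) n)%:C).
  apply/funext => n; rewrite /series/= !(raddf_sum (real_complex R)) mulr_sumr.
  rewrite -big_split /=.
  by apply: eq_bigr => k _; rewrite expi_coeffE [LHS]complexE.
rewrite [expi t]complexE /=.
apply: (@cvgD (complexF R) (complexF R)).
  by apply: cvg_real_complex; rewrite unlock; exact: is_cvg_series_cos_coeff.
apply: (@cvgM (complexF R)); first exact: cvg_cst.
by apply: cvg_real_complex; rewrite unlock; exact: is_cvg_series_sin_coeff.
Qed.

End ComplexLimits.

(** * The exponential of a normal matrix through its spectrum *)

Lemma cvg_mx_entrywise (T : topologicalType) S (F : set_system S) {FF : Filter F} m n
    (u : S -> 'M[T]_(m, n)) (A : 'M[T]_(m, n)) :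
  (forall i j, (fun k => u k i j) @ F --> A i j) -> u @ F --> A.
Proof.
move=> uA B [P nP sPB]; rewrite nbhs_filterE /fmap/=.
(* There are finitely many entries, so the eventual conditions on them hold simultaneously. *)
have : \forall k \near F, forall i j, P i j (u k i j).
  by apply: filter_forall => i; apply: filter_forall => j; exact: uA (nP i j).
by apply: filterS => k Pk; apply: sPB.
Qed.

Lemma scale_exp_diagonalizable (K : comUnitRingType) n (c a : K) (P : 'M[K]_n)
    (d : 'rV[K]_n) k : P \in unitmx ->
  c *: (a *: (invmx P *m diag_mx d *m P)) ^+ k =
    invmx P *m diag_mx (\row_i (c * (a * d 0 i) ^+ k)) *m P.
Proof.
move=> Pu.
have -> : (a *: (invmx P *m diag_mx d *m P)) ^+ k =
    invmx P *m diag_mx (\row_i (a * d 0 i) ^+ k) *m P.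
  elim: k => [|k IH].
    rewrite expr0 -[LHS](mulVmx Pu) -[in LHS](mulmx1 (invmx P)).
    by congr (_ *m _ *m _); apply/matrixP => i j; rewrite !mxE.
  rewrite exprS IH -[_ * _]/(_ *m _) -scalemxAl !mulmxA mulmxK //.
  rewrite -(mulmxA _ (diag_mx d)) mulmx_diag scalemxAl scalemxAr.
  congr (_ *m _ *m _); apply/matrixP => i j; rewrite !mxE.
  by rewrite -mulrnAr exprS mulrA mulrnAr.
rewrite scalemxAl scalemxAr; congr (_ *m _ *m _).
by apply/matrixP => i j; rewrite !mxE mulrnAr.
Qed.

Lemma scaler_exp_mx (K : comPzRingType) n (a : K) (A : 'M[K]_n) k :
  (a *: A) ^+ k = a ^+ k *: A ^+ k.
Proof.
elim: k => [|k IH]; first by rewrite !expr0 scale1r.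
by rewrite !exprSr IH -![_ * _]/(_ *m _) -scalemxAl -scalemxAr scalerA.
Qed.

Section SpectralExponential.
Variables (C : numClosedFieldType) (n : nat) (L : 'M[C]_n) (a : C) (f : C -> C).
Hypothesis normalL : L \is normalmx.

Let P := spectralmx L.
Let d := spectral_diag L.

Hypothesis cvg_f : forall i,
  series (fun k => (k`!%:R)^-1 * (a * d 0 i) ^+ k) @ \oo --> f (d 0 i).

(** The functional calculus f(L). The hypothesis [cvg_f] constrains [f] on the spectrum alone, so
    [f] may later be defined through the real part of its argument. *)
Definition spectral_fun_mx : 'M[C]_n :=
  invmx P *m diag_mx (\row_i f (d 0 i)) *m P.

(** In the eigenbasis each entry of a partial sum is a fixed finite linear combination of scalar
    exponential sums, one per eigenvalue. *)
Lemma cvg_exp_entry i j :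
  series (fun k => ((k`!%:R)^-1 *: (a *: L) ^+ k) i j) @ \oo
    --> spectral_fun_mx i j.
Proof.
have entryE (g : 'I_n -> C) :
    (invmx P *m diag_mx (\row_l g l) *m P) i j = \sum_l invmx P i l * g l * P l j.
  by rewrite mul_mx_diag mxE; apply: eq_bigr => l _; rewrite !mxE.
rewrite /spectral_fun_mx entryE.
have -> : series (fun k => ((k`!%:R)^-1 *: (a *: L) ^+ k) i j) =
    (fun N => \sum_l invmx P i l
       * series (fun k => (k`!%:R)^-1 * (a * d 0 l) ^+ k) N * P l j).
  apply/funext => N; rewrite /series/=.
  have LE k : (k`!%:R)^-1 *: (a *: L) ^+ k =
      invmx P *m diag_mx (\row_l ((k`!%:R)^-1 * (a * d 0 l) ^+ k)) *m P.
    by rewrite {1}(orthomx_spectralP normalL) scale_exp_diagonalizable ?spectral_unit.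
  under eq_bigr do rewrite LE entryE.
  rewrite exchange_big; apply: eq_bigr => l _; rewrite mulr_sumr mulr_suml.
  exact: eq_bigr.
apply: cvg_big => [|l _]; first exact: add_continuous.
by apply: cvgM; [apply: cvgM; [exact: cvg_cst|exact: cvg_f]|exact: cvg_cst].
Qed.

Lemma expmx_spectral : expmx (a *: L) = spectral_fun_mx.
Proof.
apply: cvg_lim; first exact: norm_hausdorff.
apply: cvg_mx_entrywise => i j.
set u := (X in series X).
have -> : (fun N => series u N i j) = series (fun k => u k i j).
  by apply/funext => N; rewrite /series/= summxE.
exact: cvg_exp_entry.
Qed.

(** Once the spectrum has secured convergence, this form computes entries of the exponential from
    those of the powers of [L]. *)
Lemma cvg_expmx_entry i j :
  series (fun k => (k`!%:R)^-1 * a ^+ k * (L ^+ k) i j) @ \oo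
    --> expmx (a *: L) i j.
Proof.
rewrite expmx_spectral.
suff -> : (fun k => (k`!%:R)^-1 * a ^+ k * (L ^+ k) i j) =
    (fun k => ((k`!%:R)^-1 *: (a *: L) ^+ k) i j) by exact: cvg_exp_entry.
by apply/funext => k; rewrite scaler_exp_mx scalerA mxE.
Qed.

Lemma spectral_fun_mx_unitary :
  (forall i, `|f (d 0 i)| = 1) -> spectral_fun_mx \is unitarymx.
Proof.
move=> f1; have Pu : P \is unitarymx by exact: spectral_unitarymx.
have Du : diag_mx (\row_i f (d 0 i)) \is unitarymx.
  apply/unitarymxP; rewrite tr_diag_mx map_diag_mx mulmx_diag.
  rewrite -[RHS]diag_const_mx; congr diag_mx; apply/rowP => i; rewrite !mxE.
  by rewrite -normCK f1 expr1n.
by rewrite /spectral_fun_mx invmx_unitary // !mul_unitarymx ?trmxC_unitary.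
Qed.

End SpectralExponential.

(** * The unitary group of a Hermitian matrix with zero row and column sums *)

Section LaplacianExponential.
Variables (R : realType) (n : nat) (L : 'M[complexF R]_n) (t : R).
Hypothesis hermL : L \is hermsymmx.

Let f (x : complexF R) : complexF R := expi (t * complex.Re x).
Let U := expmx (('i * t%:C : complexF R) *: L).

(** Eigenvalues of a Hermitian matrix are real, so [complex.Re] in [f] loses nothing. *)
Lemma cvg_expi_eigen i :
  series (fun k => (k`!%:R)^-1
      * (('i * t%:C : complexF R) * spectral_diag L 0 i) ^+ k) @ \oo
  --> f (spectral_diag L 0 i).
Proof.
have /mxOverP/(_ 0 i) := hermitian_spectral_diag_real hermL.
move: (spectral_diag L 0 i) => x /RRe_real xE.
suff -> : (fun k => (k`!%:R)^-1 * (('i * t%:C : complexF R) * x) ^+ k) =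
    expi_coeff (t * complex.Re x) by exact: cvg_expi.
apply/funext => k; rewrite /expi_coeff; congr (_ * _ ^+ _).
by rewrite -mulrA -{1}xE -rmorphM.
Qed.

Lemma expmx_herm_unitary : U \is unitarymx.
Proof.
rewrite /U (expmx_spectral (hermitian_normalmx hermL) cvg_expi_eigen).
apply: spectral_fun_mx_unitary => i.
by rewrite normc_def /= cos2Dsin2 sqrtr1.
Qed.

Lemma cvg_expmx_herm i j :
  series (fun k => (k`!%:R)^-1 * ('i * t%:C) ^+ k * (L ^+ k) i j : complexF R) @ \oo
  --> U i j.
Proof. exact: (cvg_expmx_entry (hermitian_normalmx hermL) cvg_expi_eigen). Qed.

Hypothesis row0 : forall i, \sum_j L i j = 0.
Hypothesis col0 : forall j, \sum_i L i j = 0.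

(** Zero column sums of [L] pass to all its positive powers, so only the identity term of the series
    contributes. *)
Lemma expmx_col_sum j : \sum_i U i j = 1.
Proof.
pose u i k : complexF R := (k`!%:R)^-1 * ('i * t%:C) ^+ k * (L ^+ k) i j.
have cvgU : (fun N => \sum_i series (u i) N) @ \oo --> \sum_i U i j.
  by apply: cvg_big => [|i _]; [exact: add_continuous | exact: cvg_expmx_herm].
have cvg1 : (fun N => \sum_i series (u i) N) @ \oo --> expi 0.
  (* The series of [expi 0] has the same terms: 1 at k = 0 and 0 afterwards. *)
  suff -> : (fun N => \sum_i series (u i) N) = series (expi_coeff 0) by exact: cvg_expi.
  apply/funext => N; rewrite /series /= exchange_big; apply: eq_bigr => k _.
  rewrite /u -mulr_sumr /expi_coeff; case: k => [|k].
    rewrite !expr0 !mulr1 (bigD1 j)//= mxE eqxx big1 ?addr0 ?mulr1// => i ij.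
    by rewrite mxE (negbTE ij).
  rewrite mulr0 expr0n /= mulr0; under eq_bigr do rewrite exprS mxE.
  rewrite exchange_big big1 ?mulr0// => l _.
  by rewrite -mulr_suml col0 mul0r.
by rewrite -expi0; exact: (cvg_unique (@norm_hausdorff _ _) cvgU cvg1).
Qed.

Lemma expmx_cross_entry (s : 'I_n -> bool) :
  (forall i j, s i != s j -> L i j = -1) ->
  forall i j, s i != s j -> U i j = (1 - expi (t * n%:R)) / n%:R.
Proof.
move=> Ls i j sij.
have n0 : n%:R != 0 :> complexF R.
  by rewrite pnatr_eq0 -lt0n (leq_ltn_trans _ (ltn_ord i)).
pose u k : complexF R := (k`!%:R)^-1 * ('i * t%:C) ^+ k * (L ^+ k) i j.
(* For k >= 1 the term is -(i t n)^k / (k! n), while the term at k = 0 vanishes because i and j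
   differ. Writing 1 as [expi 0] cancels the constant term of the other exponential, so the series
   match term by term. *)
have cvgu : series u @ \oo --> (expi 0 - expi (t * n%:R)) / n%:R; last first.
  rewrite -[X in X - _]expi0.
  exact: (cvg_unique (@norm_hausdorff _ _) (@cvg_expmx_herm i j) cvgu).
suff -> : series u =
   (fun N => (series (expi_coeff 0) N - series (expi_coeff (t * n%:R)) N) / n%:R).
  apply: cvgM; last exact: cvg_cst.
  by apply: cvgB; exact: cvg_expi.
apply/funext => N; rewrite /series /= -sumrB mulr_suml; apply: eq_bigr => k _.
rewrite /u /expi_coeff; case: k => [|k].
  rewrite !expr0 subrr mul0r mxE; have [ij|_] := eqVneq i j; last by rewrite mulr0.
  by rewrite ij eqxx in sij.
rewrite (cross_entry_exp row0 col0 Ls)// mulr0 expr0n /= mulr0 sub0r.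
rewrite rmorphM rmorph_nat mulrA [in RHS]exprMn [n%:R ^+ k.+1]exprSr.
by rewrite mulNr mulrN !mulrA mulfK.
Qed.
End LaplacianExponential.

(** * The graph Laplacian and the two sides of a join *)

Lemma laplacian_row_sum (K : pzRingType) (Z : sgraph) i :
  \sum_j laplacian_mx K Z i j = 0.
Proof.
under eq_bigr do rewrite !mxE; rewrite sumrB.
rewrite (bigD1 i) //= eqxx mulr1n big1 ?addr0; last first.
  by move=> j ji; rewrite eq_sym (negbTE ji).
rewrite -natr_sum; apply/eqP; rewrite subr_eq0; apply/eqP; congr (_%:R).
rewrite /degree cardsE -sum1_card big_mkcond /=.
rewrite (reindex (enum_val : 'I_#|Z| -> Z)) /=; last exact: (onW_bij _ (@enum_val_bij Z)).
apply: eq_bigr => j _.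
by rewrite -[enum_val j \in _]/(adj (enum_val i) (enum_val j)); case: adj.
Qed.

Lemma laplacian_sym (K : pzRingType) (Z : sgraph) i j :
  laplacian_mx K Z i j = laplacian_mx K Z j i.
Proof.
rewrite !mxE adj_sym; congr (_ - _).
by have [->|ij] := eqVneq i j; rewrite ?eqxx // eq_sym (negbTE ij).
Qed.

Lemma laplacian_hermsym (C : numClosedFieldType) (Z : sgraph) :
  laplacian_mx C Z \is hermsymmx.
Proof.
apply/is_hermitianmxP; rewrite expr0 scale1r; apply/matrixP => i j.
rewrite [LHS]laplacian_sym !mxE rmorphB rmorph_nat; congr (_ - _).
by rewrite rmorphMn rmorph_nat.
Qed.

(** This two-colouring is all that the proof retains of the join; edges inside a side are left
    arbitrary. *)
Lemma is_join_side (Z : sgraph) : is_join Z ->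
  exists s : Z -> bool, (forall u v, s u != s v -> adj u v) /\
    (forall a, exists b, s b != s a).
Proof.
move=> [X [Y [/card_gt0P[x _] /card_gt0P[y _] [f [g fK gK] fadj]]]].
exists (fun v => if f v is inl _ then true else false); split=> [u v|a].
  by rewrite -fadj /=; case: (f u) (f v) => [?|?] [?|?].
by case: (f a) => _; [exists (g (inr y)) | exists (g (inl x))]; rewrite gK.
Qed.

(** * Unitarity against the cross entries *)

Lemma unitary_col_norm (C : numClosedFieldType) n (U : 'M[C]_n) j :
  U \is unitarymx -> \sum_i `|U i j| ^+ 2 = 1.
Proof.
(* [unitarymx] asserts orthonormal rows, hence the passage to the transpose. *)
rewrite -trmx_unitary => /unitarymxP/matrixP/(_ j j); rewrite !mxE eqxx => Ujj.
rewrite -[RHS]Ujj; by apply: eq_bigr => i _; rewrite !mxE normCK.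
Qed.

Lemma cross_weight_cos (R : realType) (n : nat) (c s : R) (alpha beta : R[i]) :
  (2 < n)%N -> c ^+ 2 + s ^+ 2 = 1 ->
  alpha + beta = 1 -> `|alpha| ^+ 2 + `|beta| ^+ 2 = 1 ->
  beta * n%:R = 1 - (c +i* s) -> c = 1.
Proof.
move=> n2 cs ab; have -> : alpha = 1 - beta by rewrite -ab addrK.
case: beta ab => x y _; rewrite -[n%:R](rmorph_nat (real_complex R)).
rewrite -!add_Re2_Im2 -rmorphD /= => -[] N; simpc => -[] xn yn.
have n3 : 2 < n%:R :> R by rewrite ltr_nat.
have cE : 1 - c = x * n%:R by rewrite xn.
have sE : s = - (y * n%:R) by rewrite yn opprK.
(* This is |beta|^2 = Re beta, from (1 - x)^2 + y^2 + x^2 + y^2 = 1. *)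
have xy : x ^+ 2 + y ^+ 2 = x by lra.
have : x * n%:R * (n%:R - 2) = 0.
  (* The left side is (1 - c)^2 + s^2 = 2 (1 - c); by [xy] it is also n^2 x. *)
  have : (x * n%:R) ^+ 2 + (y * n%:R) ^+ 2 = 2 * (x * n%:R).
    by rewrite -cE -[(y * _) ^+ 2]sqrrN -sE; nra.
  by rewrite !exprMn -mulrDl xy; nra.
move/eqP; rewrite mulf_eq0 -cE subr_eq0 => /orP[/eqP ->//|]; lra.
Qed.

Lemma mulmx_basis_vec (K : pzRingType) (Z : sgraph) (U : 'M[K]_#|Z|) (a b : Z)
    (alpha beta : K) :
  U *m basis_vec K a = alpha *: basis_vec K a + beta *: basis_vec K b ->
  forall v, U (enum_rank v) (enum_rank a) = alpha *+ (v == a) + beta *+ (v == b).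
Proof.
rewrite /basis_vec -colE => /matrixP Ua v; have := Ua (enum_rank v) 0.
by rewrite !mxE !andbT !(inj_eq enum_rank_inj) !mulr_natr.
Qed.

Lemma unitary_revival_cos (R : realType) (Z : sgraph) (U : 'M[R[i]]_#|Z|)
    (s : Z -> bool) (a b : Z) (alpha beta : R[i]) (t : R) :
  (2 < #|Z|)%N -> a != b -> (exists v, s v != s a) ->
  U \is unitarymx -> \sum_i U i (enum_rank a) = 1 ->
  (forall v, s v != s a ->
    U (enum_rank v) (enum_rank a) = (1 - expi t) / #|Z|%:R) ->
  U *m basis_vec R[i] a = alpha *: basis_vec R[i] a + beta *: basis_vec R[i] b ->
  cos t = 1.
Proof.
move=> n3 ab [y sya] Uunitary Usum Ucross /mulmx_basis_vec Ucol.
have n0 : #|Z|%:R != 0 :> R[i] by rewrite pnatr_eq0 -lt0n (ltn_trans _ n3).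
have Uaa : U (enum_rank a) (enum_rank a) = alpha.
  by rewrite Ucol eqxx (negbTE ab) addr0.
have Uba : U (enum_rank b) (enum_rank a) = beta.
  by rewrite Ucol eqxx eq_sym (negbTE ab) add0r.
have U0 v : v != a -> v != b -> U (enum_rank v) (enum_rank a) = 0.
  by move=> /negbTE va /negbTE vb; rewrite Ucol va vb addr0.
(* Used with the identity for the column sum and with the squared modulus for the column norm. *)
have colsum (F : R[i] -> R[i]) : F 0 = 0 ->
    \sum_i F (U i (enum_rank a)) = F alpha + F beta.
  move=> F0; rewrite (reindex (enum_rank : Z -> _)) /=; last first.
    exact: (onW_bij _ (@enum_rank_bij Z)).
  rewrite (bigD1 a) //= (bigD1 b) 1?eq_sym//= big1 ?addr0 ?Uaa ?Uba//.
  by move=> v /andP[va vb]; rewrite U0.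
have [sba|sba] := eqVneq (s b) (s a); last first.
  apply: (@cross_weight_cos _ _ _ (sin t) alpha beta n3); first exact: cos2Dsin2.
  - by rewrite -(colsum id).
  - by rewrite -(colsum (fun x => `|x| ^+ 2)) ?normr0 ?expr0n// unitary_col_norm.
  - by rewrite -Uba Ucross// mulfVK.
(* Now a and b share a side, so y on the other side is neither of them and its entry is 0. *)
have yb : y != b by apply: contraNneq sya => ->; rewrite sba.
have ya : y != a by apply: contraNneq sya => ->.
have := Ucross y sya; rewrite U0// => /esym/eqP.
rewrite mulf_eq0 invr_eq0 (negbTE n0) orbF subr_eq0 eq_sym eq_complex /=.
by case/andP=> /eqP.
Qed.

Theorem theorem11p1 (R : realType) (Z : sgraph) (tau : R) :
  is_join Z -> (3 <= #|Z|)%N ->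
  admits_laplacian_fractional_revival Z tau ->
  exists m : int, tau = m%:~R * (2 * pi / #|Z|%:R).
Proof.
move=> /is_join_side[s [s_adj s_other]] n3 [a [b [ab [alpha [beta revival]]]]].
have n0 : #|Z|%:R != 0 :> R by rewrite pnatr_eq0 -lt0n (ltn_trans _ n3).
suff cos1 : cos (tau * #|Z|%:R) = 1.
  have [m tauE] := cos_eq1 cos1; exists m.
  by rewrite mulrA -tauE mulfK.
have herm := laplacian_hermsym (R[i] : numClosedFieldType) Z.
have row0 := @laplacian_row_sum R[i] Z.
have col0 j : \sum_i laplacian_mx R[i] Z i j = 0.
  by rewrite -[RHS](row0 j); apply: eq_bigr => i _; rewrite laplacian_sym.
apply: (unitary_revival_cos n3 ab (s_other a) _ _ _ revival).
- exact: (expmx_herm_unitary tau herm).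
- exact: (expmx_col_sum tau herm col0).
(* The colouring is carried to matrix indices by [enum_val]. Across the sides the indices differ, so
   the degree part vanishes and the entry is -1. *)
move=> v sva; apply: (expmx_cross_entry (s := s \o enum_val) tau herm row0 col0).
  move=> i j sij /=; rewrite !mxE s_adj//.
  have [ijE|_] := eqVneq i j; last by rewrite sub0r.
  by rewrite ijE eqxx in sij.
by rewrite /= !enum_rankK.
Qed.
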